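(* Let $X$ be a geodesic space and $n\geq 3$. (i) The quasiconvexity constant of $FS_n(X)$ is at least $2$; that is, if $\lambda\geq 1$ and $FS_n(X)$ is $\lambda$-quasiconvex, then $\lambda\geq 2$. (ii) $FS_n(X)$ is not geodesic (i.e., the quasiconvexity constant of $FS_n(X)$ exceeds $1$).
   Context: For a metric space $X=(X,d)$ and an integer $n\geq 1$, $FS_n(X)$ is the set of nonempty subsets of $X$ with at most $n$ elements, a metric space with the Hausdorff distance $d_H(A,B)=\max\{\max_{a\in A}\min_{b\in B}d(a,b),\ \max_{b\in B}\min_{a\in A}d(a,b)\}$. For $\lambda\geq1$, a path (continuous map) $\gamma:[0,1]\to Y$ in a metric space $Y$ is a $\lambda$-quasigeodesic if $d(\gamma(t),\gamma(t'))\leq\lambda d(\gamma(0),\gamma(1))|t-t'|$ for all $t,t'\in[0,1]$. $Y$ is $\lambda$-quasiconvex (with quasiconvexity constant $\lambda$) if every two points of $Y$ are connected by a $\lambda$-quasigeodesic in $Y$; $Y$ is geodesic if it is $1$-quasiconvex.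
   Formalization: The geodesic space X is assumed to have at least two distinct points; if X is empty or a single point, FS_n(X) has at most one point and is geodesic, so both (i) and (ii) would fail. *)

(* Defs.v *)
From HB Require Import structures.
From mathcomp Require Import all_boot all_order all_algebra finmap.
From mathcomp Require Import all_classical all_reals all_analysis.

Set Implicit Arguments.
Unset Strict Implicit.
Unset Printing Implicit Defensive.

Import Order.TTheory GRing.Theory Num.Theory.
Import numFieldTopology.Exports.

Local Open Scope classical_set_scope.
Local Open Scope fset_scope.
Local Open Scope ring_scope.

(* Only the values of [g] on [0, 1] matter: a path [0, 1] -> Y is represented
   by a total function R -> Y that is continuous on the subspace [0, 1]. *)
Definition quasigeodesic (R : realType) (Y : metricType R) (lambda : R)
    (g : R -> Y) : Prop :=
  {within `[0, 1], continuous g} /\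
  (forall t t' : R, t \in `[0, 1] -> t' \in `[0, 1] ->
     mdist (g t) (g t') <= lambda * mdist (g 0) (g 1) * `|t - t'|).

Definition quasiconvex (R : realType) (Y : metricType R) (lambda : R) : Prop :=
  forall x y : Y, exists g : R -> Y,
    [/\ quasigeodesic lambda g, g 0 = x & g 1 = y].

Definition geodesic_space (R : realType) (Y : metricType R) : Prop :=
  quasiconvex Y 1.

Record FS (R : realType) (n : nat) (X : metricType R) := MkFS {
  fs_set :> {fset X} ;
  fs_setP : (fs_set != fset0) && (#|` fs_set| <= n)%N
}.

HB.instance Definition _ (R : realType) (n : nat) (X : metricType R) :=
  [isSub of FS n X for @fs_set R n X].
HB.instance Definition _ (R : realType) (n : nat) (X : metricType R) :=
  [Choice of FS n X by <:].

(* For nonempty finite sets the infimum is a minimum ([dist_to_min]) and the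
   supremum is a maximum ([excess_max]). *)
Definition dist_to (R : realType) (X : metricType R) (a : X) (B : {fset X}) : R :=
  inf [set mdist a b | b in [set` B]].

Definition excess (R : realType) (X : metricType R) (A B : {fset X}) : R :=
  sup [set dist_to a B | a in [set` A]].

Definition hausdorff_dist (R : realType) (X : metricType R)
    (A B : {fset X}) : R :=
  Num.max (excess A B) (excess B A).

Section hausdorff_theory.
Context {R : realType} {X : metricType R}.
Implicit Types (a b : X) (A B C : {fset X}).

Lemma dist_to_min a B : B != fset0 ->
  exists b, [/\ b \in B, dist_to a B = mdist a b &
    forall b', b' \in B -> mdist a b <= mdist a b'].
Proof.
move=> /fset0Pn[b0 b0B].
pose F (b : B) : R := mdist a (val b).
have [b _ bmin] := @Order.TotalTheory.arg_minP _ _ B [` b0B] xpredT F isT.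
have bm b' : b' \in B -> mdist a (val b) <= mdist a b'.
  by move=> b'B; exact: (bmin [` b'B]).
exists (val b); split => //; first exact: valP.
apply/eqP; rewrite eq_le; apply/andP; split.
  apply: ge_inf; first by exists (mdist a (val b)) => _ [b' /= b'B <-]; exact: bm.
  by exists (val b) => //=; exact: valP.
apply: lb_le_inf; first by exists (mdist a b0), b0.
by move=> _ [b' /= b'B <-]; exact: bm.
Qed.

Lemma excess_max A B : A != fset0 ->
  exists a, [/\ a \in A, excess A B = dist_to a B &
    forall a', a' \in A -> dist_to a' B <= dist_to a B].
Proof.
move=> /fset0Pn[a0 a0A].
pose F (a : A) : R := dist_to (val a) B.
have [a _ amax] := @Order.TotalTheory.arg_maxP _ _ A [` a0A] xpredT F isT.
have am a' : a' \in A -> dist_to a' B <= dist_to (val a) B.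
  by move=> a'A; exact: (amax [` a'A]).
exists (val a); split => //; first exact: valP.
apply/eqP; rewrite eq_le; apply/andP; split.
  apply: ge_sup; first by exists (dist_to a0 B), a0.
  by move=> _ [a' /= a'A <-]; exact: am.
apply: ub_le_sup; first by exists (dist_to (val a) B) => _ [a' /= a'A <-]; exact: am.
by exists (val a) => //=; exact: valP.
Qed.

Lemma excess_leP A B r : A != fset0 -> B != fset0 ->
  excess A B <= r <->
  (forall a, a \in A -> exists2 b, b \in B & mdist a b <= r).
Proof.
move=> A0 B0; have [a [aA -> am]] := excess_max B A0; split=> [ar a' a'A|h].
  have [b [bB e _]] := dist_to_min a' B0.
  by exists b => //; rewrite -e (le_trans (am _ a'A)).
have [b [bB -> bm]] := dist_to_min a B0.
by have [b' b'B] := h a aA; apply: le_trans; exact: bm.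
Qed.

Lemma hausdorff_dist_leP A B r : A != fset0 -> B != fset0 ->
  hausdorff_dist A B <= r <->
  (forall a, a \in A -> exists2 b, b \in B & mdist a b <= r) /\
  (forall b, b \in B -> exists2 a, a \in A & mdist b a <= r).
Proof.
move=> A0 B0; rewrite /hausdorff_dist ge_max; split.
  by move=> /andP[/(excess_leP _ A0 B0) ? /(excess_leP _ B0 A0)].
by case=> /(excess_leP _ A0 B0) -> /(excess_leP _ B0 A0) ->.
Qed.

Lemma hausdorff_distC A B : hausdorff_dist A B = hausdorff_dist B A.
Proof. by rewrite /hausdorff_dist maxC. Qed.

Lemma hausdorff_dist_ge0 A B : A != fset0 -> B != fset0 ->
  0 <= hausdorff_dist A B.
Proof.
move=> A0 B0; have /(hausdorff_dist_leP _ A0 B0)[+ _] := lexx (hausdorff_dist A B).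
by have /fset0Pn[a aA] := A0 => /(_ a aA)[b _]; apply: le_trans; exact: mdist_ge0.
Qed.

Lemma hausdorff_distxx A : A != fset0 -> hausdorff_dist A A = 0.
Proof.
move=> A0; apply/eqP; rewrite eq_le hausdorff_dist_ge0// andbT.
apply/hausdorff_dist_leP => //.
by split=> a aA; exists a => //; rewrite mdistxx.
Qed.

Lemma hausdorff_dist_eq0 A B : A != fset0 -> B != fset0 ->
  hausdorff_dist A B = 0 -> A = B.
Proof.
move=> A0 B0 /eqP; rewrite eq_le => /andP[/(hausdorff_dist_leP _ A0 B0)[h1 h2] _].
have mdist_le0 (x y : X) : mdist x y <= 0 -> x = y.
  by move=> xy; apply: mdist_positivity; apply/eqP; rewrite eq_le xy mdist_ge0.
apply/fsetP => x; apply/idP/idP => [/h1|/h2] [y yB /mdist_le0 ->] //.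
Qed.

Lemma hausdorff_dist_triangle B A C :
  A != fset0 -> B != fset0 -> C != fset0 ->
  hausdorff_dist A C <= hausdorff_dist A B + hausdorff_dist B C.
Proof.
move=> A0 B0 C0; apply/hausdorff_dist_leP => //.
have /(hausdorff_dist_leP _ A0 B0)[AB BA] := lexx (hausdorff_dist A B).
have /(hausdorff_dist_leP _ B0 C0)[BC CB] := lexx (hausdorff_dist B C).
split=> [a /AB[b /BC[c cC bc] ab]|c /CB[b /BA[a aA ba] cb]].
  by exists c => //; rewrite (le_trans (metric_triangle _ b _))// lerD.
by exists a => //; rewrite (le_trans (metric_triangle _ b _))// addrC lerD.
Qed.

End hausdorff_theory.

Section FS_metric.
Context {R : realType} {n : nat} {X : metricType R}.
Implicit Types A B C : FS n X.

Lemma FS_neq0 A : (A : {fset X}) != fset0.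
Proof. by have /andP[] := fs_setP A. Qed.

Lemma FS_card A : (#|` (A : {fset X})| <= n)%N.
Proof. by have /andP[] := fs_setP A. Qed.

Let FS_dist A B : R := hausdorff_dist A B.

Let FS_distxx A : FS_dist A A = 0.
Proof. exact/hausdorff_distxx/FS_neq0. Qed.

Let FS_dist_eq0 A B : FS_dist A B = 0 -> A = B.
Proof. by move=> AB; apply/val_inj/hausdorff_dist_eq0 => //; exact: FS_neq0. Qed.

Let FS_distC A B : FS_dist A B = FS_dist B A.
Proof. exact: hausdorff_distC. Qed.

Let FS_dist_triangle B A C : FS_dist A C <= FS_dist A B + FS_dist B C.
Proof. by apply: hausdorff_dist_triangle; exact: FS_neq0. Qed.

HB.instance Definition _ := @isMetric.Build R (FS n X)
  FS_dist FS_distxx FS_dist_eq0 FS_distC FS_dist_triangle.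

Lemma FS_mdistE A B : mdist A B = hausdorff_dist A B.
Proof. by []. Qed.

End FS_metric.

(* Main.v *)
Require Import Defs.
From mathcomp Require Import all_boot all_order all_algebra finmap.
From mathcomp Require Import all_classical all_reals all_analysis.
From mathcomp Require Import zify ring lra.

(** The obstruction lies at the midpoint of a path.  If [FS n X] is
    [lambda]-quasiconvex with [lambda < 2], then any [A] and [B] at distance at
    most [d > 0] admit some [C] in [FS n X] at distance less than [d] from
    both: the value at time [1/2] of a quasigeodesic ([quasiconvex_midpoint]).
    Such a [C] meets the open ball of radius [d] around every point of the
    union of [A] and [B], so it has at least as many points as this union has
    points pairwise [2 * d] apart ([leq_card_separated]).  The theorem follows
    by choosing [A] and [B] with at most [n] points each whose union contains
    [n + 1] such points.

    On a geodesic, with [d] as the unit of length, [A] and [B] can be taken as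
<<
      A :  0    2       5       8  10  12 .. 2n
      B :     1      4     6    8  10  12 .. 2n
>>
    Near the first group of positions [A] has two points where [B] has one,
    near the second group it is the other way around; the even positions
    [0, 2, 4, .., 2n] all occur in the union.  Intuitively, on the way from
    [A] to [B] the pair [0, 2] cannot merge before time [1 / lambda], and the
    pair [4, 6] must have split by time [1 - 1 / lambda], while there is no
    room for both pairs at once.  Two pairs need [n >= 3]. *)

Set Implicit Arguments.
Unset Strict Implicit.
Unset Printing Implicit Defensive.

Import Order.TTheory GRing.Theory Num.Theory.

Local Open Scope ring_scope.

(** The triangle inequality through [g t] and [g t'] leaves no slack when the
    three upper bounds of a [1]-quasigeodesic add up to [mdist (g 0) (g 1)]. *)
Lemma quasigeodesic1_mdist (R : realType) (X : metricType R) (g : R -> X)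
    (t t' : R) : quasigeodesic 1 g -> 0 <= t <= 1 -> 0 <= t' <= 1 ->
  mdist (g t) (g t') = mdist (g 0) (g 1) * `|t - t'|.
Proof.
case=> _ glip; wlog le_tt' : t t' / t <= t' => [hwlog tI t'I|].
  have [/hwlog|/ltW /hwlog] := leP t t'; first exact.
  by rewrite metric_sym distrC; exact.
move=> /andP[t0 t1] /andP[t'0 t'1].
have lip u v : 0 <= u <= 1 -> 0 <= v <= 1 -> u <= v ->
    mdist (g u) (g v) <= mdist (g 0) (g 1) * (v - u).
  move=> uI vI uv; have := glip u v; rewrite !in_itv/= => /(_ uI vI).
  by rewrite mul1r distrC ger0_norm ?subr_ge0.
have h1 : mdist (g 0) (g t) <= mdist (g 0) (g 1) * (t - 0) by apply: lip; lra.
have h2 : mdist (g t) (g t') <= mdist (g 0) (g 1) * (t' - t) by apply: lip; lra.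
have h3 : mdist (g t') (g 1) <= mdist (g 0) (g 1) * (1 - t') by apply: lip; lra.
have tri1 := metric_triangle (g 0) (g t) (g 1).
have tri2 := metric_triangle (g t) (g t') (g 1).
rewrite distrC ger0_norm ?subr_ge0//; lra.
Qed.

Lemma geodesic_equally_spaced (R : realType) (X : metricType R) (m : nat) :
  (exists x y : X, x != y) -> geodesic_space X -> (0 < m)%N ->
  exists (P : nat -> X) (d : R), 0 < d /\
    forall k l : nat, (k <= m)%N -> (l <= m)%N ->
      mdist (P k) (P l) = d * `|k%:R - l%:R|.
Proof.
move=> [x [y neq_xy]] geoX m0; have [g [gg g0 g1]] := geoX x y.
have m0R : 0 < m%:R :> R by rewrite ltr0n.
exists (fun k => g (k%:R / m%:R)), (mdist x y / m%:R); split.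
  by rewrite divr_gt0// mdist_gt0.
have unit k : (k <= m)%N -> 0 <= (k%:R / m%:R : R) <= 1.
  by move=> km; rewrite divr_ge0 ?ler0n//= ler_pdivrMr// mul1r ler_nat.
move=> k l km lm; rewrite (quasigeodesic1_mdist gg) ?unit// g0 g1.
by rewrite -mulrBl normrM (ger0_norm (_ : 0 <= m%:R^-1)) ?invr_ge0 ?ler0n//; ring.
Qed.

(** Open balls of radius [d] around points [2 * d] apart are disjoint. *)
Lemma leq_card_separated (R : realType) (X : metricType R) (m : nat)
    (c : 'I_m -> X) (C : {fset X}) (d : R) :
  (forall i j, i != j -> 2 * d <= mdist (c i) (c j)) ->
  (forall i, exists2 x, x \in C & mdist (c i) x < d) ->
  (m <= #|` C|)%N.
Proof.
move=> sep near; have near' i : exists x : C, mdist (c i) (val x) < d.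
  by have [x xC] := near i; exists [` xC]%fset.
have [f fP] := choice near'.
have f_inj : injective f.
  move=> i j fij; apply/eqP; apply/negPn/negP => /sep; apply/negP; rewrite -ltNge.
  apply: le_lt_trans (metric_triangle _ (val (f i)) _) _.
  by have := fP j; rewrite -fij [mdist (c j) _]metric_sym; have := fP i; lra.
by rewrite cardfE -[m]card_ord; exact: leq_card f_inj.
Qed.

Lemma FS_of_family (R : realType) (X : metricType R) (n : nat) (f : 'I_n -> X) :
  (0 < n)%N ->
  exists A : FS n X, forall x, x \in fs_set A <-> exists i, x = f i.
Proof.
move=> n0; pose S : {fset X} := [fset f i | i in 'I_n]%fset.
have SP : (S != fset0)%fset && (#|` S| <= n)%N.
  apply/andP; split; last first.
    by rewrite (leq_trans (leq_imfset_card _ _ _))// size_enum_ord.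
  by apply/fset0Pn; exists (f (Ordinal n0)); apply/imfsetP; exists (Ordinal n0).
exists (MkFS SP) => x; split=> [/imfsetP[i _ ->]|[i ->]]; first by exists i.
by apply/imfsetP; exists i.
Qed.

Lemma quasiconvex_midpoint (R : realType) (Y : metricType R) (lambda : R)
    (x y : Y) : quasiconvex Y lambda ->
  exists z, mdist x z <= lambda * mdist x y / 2 /\
            mdist y z <= lambda * mdist x y / 2.
Proof.
move=> /(_ x y)[g [[_ glip] <- <-]]; exists (g 2^-1).
have I0 : (0 : R) \in `[0, 1] by rewrite in_itv/= lexx ler01.
have I1 : (1 : R) \in `[0, 1] by rewrite in_itv/= lexx ler01.
have I2 : (2^-1 : R) \in `[0, 1] by rewrite in_itv/=; lra.
split; [have := glip _ _ I0 I2 | have := glip _ _ I1 I2].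
  by rewrite sub0r normrN ger0_norm// invr_ge0.
by rewrite ger0_norm; [rewrite (_ : 1 - 2^-1 = 2^-1 :> R)//; field | lra].
Qed.

Lemma FS_mdist_near (R : realType) (X : metricType R) (n : nat) (A B : FS n X)
    (a : X) : a \in fs_set A ->
  exists2 b, b \in fs_set B & mdist a b <= mdist A B.
Proof.
move=> aA; have := lexx (mdist A B).
by rewrite {1}FS_mdistE => /(hausdorff_dist_leP _ (FS_neq0 A) (FS_neq0 B))[/(_ a aA)].
Qed.

Lemma quasiconvex_card_separated (R : realType) (X : metricType R) (n m : nat)
    (lambda d : R) (A B : FS n X) (c : 'I_m -> X) :
  0 <= lambda < 2 -> quasiconvex (FS n X) lambda -> 0 < d -> mdist A B <= d ->
  (forall i, (c i \in fs_set A) || (c i \in fs_set B)) ->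
  (forall i j, i != j -> 2 * d <= mdist (c i) (c j)) ->
  (m <= n)%N.
Proof.
move=> /andP[lambda0 lambda2] qc d0 ABd cAB sep.
have [C [AC BC]] := quasiconvex_midpoint A B qc.
have small : lambda * mdist A B / 2 < d.
  rewrite ltr_pdivrMr// (le_lt_trans (ler_wpM2l lambda0 ABd))//.
  by rewrite mulrC ltr_pM2l.
apply: leq_trans (FS_card C); apply: leq_card_separated sep _ => i.
by have /orP[/(FS_mdist_near C)|/(FS_mdist_near C)] := cAB i => -[x xC cx];
  exists x => //; apply: le_lt_trans cx (le_lt_trans _ small).
Qed.

(** Positions, in units of [d], of the points of the two sets of the example;
    they agree from the fourth one on. *)
Definition posA (i : nat) : nat :=
  match i with 0 => 0 | 1 => 2 | 2 => 5 | _ => 2 * i + 2 end.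
Definition posB (i : nat) : nat :=
  match i with 0 => 1 | 1 => 4 | 2 => 6 | _ => 2 * i + 2 end.

Lemma posA_le n i : (3 <= n)%N -> (i < n)%N -> (posA i <= 2 * n)%N.
Proof. by case: i => [|[|[|i]]] /=; lia. Qed.

Lemma posB_le n i : (3 <= n)%N -> (i < n)%N -> (posB i <= 2 * n)%N.
Proof. by case: i => [|[|[|i]]] /=; lia. Qed.

Lemma posA_near_posB n i : (3 <= n)%N -> (i < n)%N ->
  exists2 j, (j < n)%N & (posA i <= (posB j).+1)%N && (posB j <= (posA i).+1)%N.
Proof.
case: i => [|[|[|i]]] n3 ltin; [exists 0%N|exists 0%N|exists 1%N|exists i.+3] => //=; lia.
Qed.

Lemma posB_near_posA n i : (3 <= n)%N -> (i < n)%N ->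
  exists2 j, (j < n)%N & (posB i <= (posA j).+1)%N && (posA j <= (posB i).+1)%N.
Proof.
case: i => [|[|[|i]]] n3 ltin; [exists 0%N|exists 2%N|exists 2%N|exists i.+3] => //=; lia.
Qed.

Lemma even_pos n k : (3 <= n)%N -> (k <= n)%N ->
  exists2 j, (j < n)%N & (posA j == 2 * k)%N || (posB j == 2 * k)%N.
Proof.
case: k => [|[|[|[|k]]]] n3 lekn;
  [exists 0%N|exists 1%N|exists 1%N|exists 2%N|exists k.+3] => //=; lia.
Qed.

Lemma ler_dist_nat (R : realType) (k l : nat) :
  (k <= l.+1)%N -> (l <= k.+1)%N -> `|k%:R - l%:R| <= 1 :> R.
Proof.
rewrite -!(ler_nat R) -!natr1 => kl lk.
by rewrite ler_norml; lra.
Qed.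

Lemma ler_double_dist_nat (R : realType) (k l : nat) :
  k != l -> 2 <= `|(2 * k)%:R - (2 * l)%:R| :> R.
Proof.
wlog lt_kl : k l / (k < l)%N => [hwlog|_].
  by case: (ltngtP k l) => // kl _; [|rewrite distrC]; apply: hwlog; lia.
rewrite distrC -natrB ?leq_mul2l ?(ltnW lt_kl)// normr_nat ler_nat; lia.
Qed.

Theorem corollary4p4 (R : realType) (X : metricType R) (n : nat)
    (hX : exists x y : X, x != y) (hgeo : geodesic_space X) (hn : (3 <= n)%N) :
  (forall lambda : R, 1 <= lambda -> quasiconvex (FS n X) lambda -> 2 <= lambda)
  /\ ~ geodesic_space (FS n X).
Proof.
suff main (lambda : R) : 1 <= lambda -> quasiconvex (FS n X) lambda -> 2 <= lambda.
  by split=> // /(main _ (lexx _)); lra.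
move=> lambda1 qc; rewrite leNgt; apply/negP => lambda2.
have n0 : (0 < n)%N by lia.
have n20 : (0 < 2 * n)%N by rewrite muln_gt0.
have [P [d [d0 Pd]]] := geodesic_equally_spaced hX hgeo n20.
have [A AP] := FS_of_family (fun i : 'I_n => P (posA i)) n0.
have [B BP] := FS_of_family (fun i : 'I_n => P (posB i)) n0.
have near k l : (k <= 2 * n)%N -> (l <= 2 * n)%N ->
    (k <= l.+1)%N && (l <= k.+1)%N -> mdist (P k) (P l) <= d.
  move=> kn ln /andP[kl lk]; rewrite Pd// -[leRHS]mulr1 ler_pM2l//.
  exact: ler_dist_nat.
have ABd : mdist A B <= d.
  rewrite FS_mdistE; apply/hausdorff_dist_leP; [exact: FS_neq0..|split].
    move=> _ /AP[i ->]; have [j ltjn ij] := posA_near_posB hn (ltn_ord i).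
    exists (P (posB j)); first by apply/BP; exists (Ordinal ltjn).
    by apply: near ij; [exact: posA_le|exact: posB_le].
  move=> _ /BP[i ->]; have [j ltjn ij] := posB_near_posA hn (ltn_ord i).
  exists (P (posA j)); first by apply/AP; exists (Ordinal ltjn).
  by apply: near ij; [exact: posB_le|exact: posA_le].
have lambdaI : 0 <= lambda < 2 by lra.
suff : (n.+1 <= n)%N by rewrite ltnn.
apply: (quasiconvex_card_separated (c := fun k : 'I_n.+1 => P (2 * k)%N) lambdaI qc d0 ABd).
  move=> k; have [j ltjn] := even_pos hn (ltn_ord k : (k <= n)%N).
  by case/orP=> /eqP <-; apply/orP; [left; apply/AP|right; apply/BP];
    exists (Ordinal ltjn).
move=> k l neq_kl; have kn := ltn_ord k; have ln := ltn_ord l.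
by rewrite Pd ?leq_mul2l//= mulrC ler_pM2l// ler_double_dist_nat.
Qed.
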